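(* Let $K\subset\mathbb{R}^d$ be a homogeneous self-similar set that is not a singleton. Then $K$ has the packing sumset property, i.e., for any integer $\ell\ge 2$ there exist compact sets $K_1,K_2,\ldots,K_\ell\subset\mathbb{R}^d$ such that $$K_1+K_2+\cdots+K_\ell\subset K\quad\text{and}\quad \dim_P K_i=\dim_P K\quad\text{for all }1\le i\le\ell .$$
   Context: $\dim_P$ denotes packing dimension, and $K_1+\cdots+K_\ell=\{x_1+\cdots+x_\ell : x_i\in K_i,\ 1\le i\le\ell\}$. A non-empty compact set $K\subset\mathbb{R}^d$ is a self-similar set if there is a finite iterated function system $\{f_j(x)=\rho_jO_jx+b_j\}_{j=1}^m$ with each $\rho_j\in(0,1)$, $b_j\in\mathbb{R}^d$, and $O_j$ a $d\times d$ orthogonal real matrix, such that $K=\bigcup_{j=1}^m f_j(K)$. It is homogeneous if it is generated by such a system in which all $\rho_jO_j$, $1\le j\le m$, are identical, i.e. $f_j(x)=\rho Ox+b_j$ with a common $\rho\in(0,1)$ and a common orthogonal matrix $O$. No separation condition is assumed. *)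

(* Defs.v *)
From HB Require Import structures.
From mathcomp Require Import all_boot all_order all_algebra.
From mathcomp Require Import all_classical all_reals all_analysis.

Set Implicit Arguments.
Unset Strict Implicit.
Unset Printing Implicit Defensive.

Import Order.TTheory GRing.Theory Num.Theory.
Import numFieldNormedType.Exports.

Local Open Scope classical_set_scope.
Local Open Scope ring_scope.

(* R^d is 'cV[R]_d. The library's norm on matrices is the sup norm, so the
   Euclidean one, in which balls are taken below, is defined here; the topology
   (used for compactness) is the same for both. *)
Definition enorm (R : realType) (d : nat) (x : 'cV[R]_d) : R :=
  Num.sqrt (\sum_(i < d) x i 0 ^+ 2).

Definition eclosed_ball (R : realType) (d : nat) (x : 'cV[R]_d) (r : R) :
    set 'cV[R]_d :=
  [set y | enorm (y - x) <= r].

(* A ball is encoded by its pair (center, radius). *)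
Definition is_packing (R : realType) (d : nat) (delta : R) (E : set 'cV[R]_d)
    (B : set ('cV[R]_d * R)) : Prop :=
  [/\ forall p, B p -> E p.1,
      forall p, B p -> 0 < p.2 <= delta &
      trivIset B (fun p => eclosed_ball p.1 p.2)].

(* The supremum, over all delta-packings, of the sum of (diameter)^s. *)
Definition packing_size (R : realType) (d : nat) (s delta : R)
    (E : set 'cV[R]_d) : \bar R :=
  ereal_sup [set \esum_(p in B) ((2 * p.2) `^ s)%:E | B in is_packing delta E].

(* packing_size is nondecreasing in delta, so that its limit as delta tends to
   0 from above is an infimum. *)
Definition packing_premeasure (R : realType) (d : nat) (s : R)
    (E : set 'cV[R]_d) : \bar R :=
  ereal_inf [set packing_size s delta E | delta in [set delta : R | 0 < delta]].

Definition packing_measure (R : realType) (d : nat) (s : R)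
    (E : set 'cV[R]_d) : \bar R :=
  ereal_inf [set (\sum_(0 <= n <oo) packing_premeasure s (F n))%E
            | F in [set F : nat -> set 'cV[R]_d | E `<=` \bigcup_n F n]].

(* With this definition the empty set has packing dimension 0. *)
Definition packing_dim (R : realType) (d : nat) (E : set 'cV[R]_d) : \bar R :=
  ereal_inf [set s%:E | s in [set s : R | 0 <= s /\ packing_measure s E = 0%E]].

Definition orthogonal_mx (R : realType) (d : nat) (O : 'M[R]_d) : Prop :=
  O *m O^T = 1%:M.

Definition similitude (R : realType) (d : nat) (rho : R) (O : 'M[R]_d)
    (b : 'cV[R]_d) (x : 'cV[R]_d) : 'cV[R]_d :=
  rho *: (O *m x) + b.

Definition self_similar_for (R : realType) (d m : nat) (rho : 'I_m -> R)
    (O : 'I_m -> 'M[R]_d) (b : 'I_m -> 'cV[R]_d) (K : set 'cV[R]_d) : Prop :=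
  [/\ K !=set0, compact K,
      forall j, 0 < rho j < 1,
      forall j, orthogonal_mx (O j) &
      K = \bigcup_(j in [set: 'I_m]) (similitude (rho j) (O j) (b j) @` K)].

Definition homogeneous_self_similar (R : realType) (d : nat)
    (K : set 'cV[R]_d) : Prop :=
  exists (m : nat) (rho : R) (O : 'M[R]_d) (b : 'I_m -> 'cV[R]_d),
    self_similar_for (fun=> rho) (fun=> O) b K.

Definition sumset (R : realType) (d l : nat) (A : 'I_l -> set 'cV[R]_d) :
    set 'cV[R]_d :=
  [set \sum_(i < l) x i | x in [set x : 'I_l -> 'cV[R]_d | forall i, A i (x i)]].

Definition packing_sumset_property (R : realType) (d : nat)
    (K : set 'cV[R]_d) : Prop :=
  forall l : nat, (2 <= l)%N ->
    exists A : 'I_l -> set 'cV[R]_d,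
      [/\ forall i, compact (A i),
          sumset A `<=` K &
          forall i, packing_dim (A i) = packing_dim K].

(* Main.v *)
(* After a translation, K is the set of all sums of A^k t_k with A = rho O and
   digits t_k in a finite set containing 0. Cut the positions k into consecutive
   blocks, each owned by one of the l summands, and let K_i be the closure of the
   finite digit sums whose nonzero digits sit at positions owned by i. Sums of
   points of the K_i lie in K because the digits never overlap. If a block
   starting at a is long enough, the digits in it reproduce a copy, scaled by
   rho^a, of any prescribed finite packing of K. For s < dim_P K there are packings
   of K with arbitrarily small radii and an arbitrarily large s-sum, which
   outweighs the factor rho^(a s), so the blocks can be chosen such that every
   nonempty relatively open part of K_i, and every dense subset of it, has infinite
   s-dimensional packing premeasure. By Baire's theorem K_i then has positive
   s-dimensional packing measure. *)
Require Import Defs.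
From mathcomp Require Import all_boot all_order all_algebra.
From mathcomp Require Import all_classical all_reals all_analysis.
From mathcomp Require Import ring lra.

Import Order.TTheory GRing.Theory Num.Theory.
Import numFieldNormedType.Exports.

Local Open Scope classical_set_scope.
Local Open Scope ring_scope.

(** * The Euclidean norm and its topology *)

Section EuclideanNorm.
Context {R : realType} {d : nat}.
Implicit Types (x y z : 'cV[R]_d) (O : 'M[R]_d) (A : set 'cV[R]_d).

Lemma sqr_enorm x : enorm x ^+ 2 = \sum_(i < d) x i 0 ^+ 2.
Proof. by rewrite sqr_sqrtr// sumr_ge0// => i _; rewrite sqr_ge0. Qed.

Lemma enorm_ge0 x : 0 <= enorm x.
Proof. exact: sqrtr_ge0. Qed.

Lemma enormZ a x : enorm (a *: x) = `|a| * enorm x.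
Proof.
rewrite /enorm -sqrtr_sqr -sqrtrM ?sqr_ge0// mulr_sumr; congr Num.sqrt.
by apply: eq_bigr => i _; rewrite mxE exprMn.
Qed.

Lemma enormN x : enorm (- x) = enorm x.
Proof. by rewrite -scaleN1r enormZ normrN1 mul1r. Qed.

Lemma enormB x y : enorm (x - y) = enorm (y - x).
Proof. by rewrite -opprB enormN. Qed.

Lemma enorm0 : enorm (0 : 'cV[R]_d) = 0.
Proof. by rewrite -(scale0r 0) enormZ normr0 mul0r. Qed.

Lemma ler_coord_enorm x i : `|x i 0| <= enorm x.
Proof.
rewrite -sqrtr_sqr ler_wsqrtr// (bigD1 i)//= lerDl sumr_ge0// => j _.
exact: sqr_ge0.
Qed.

Lemma enorm_eq0 x : enorm x = 0 -> x = 0.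
Proof.
move=> x0; apply/matrixP => i j; rewrite !ord1 mxE; apply/eqP.
by rewrite -normr_le0 -x0 ler_coord_enorm.
Qed.

Lemma cauchy_schwarz x y : \sum_(i < d) x i 0 * y i 0 <= enorm x * enorm y.
Proof.
have [x0|x0] := eqVneq (enorm x) 0.
  by rewrite x0 mul0r (enorm_eq0 _ x0) big1// => i _; rewrite mxE mul0r.
have [y0|y0] := eqVneq (enorm y) 0.
  by rewrite y0 mulr0 (enorm_eq0 _ y0) big1// => i _; rewrite mxE mulr0.
have xy : 0 < enorm x * enorm y by rewrite mulr_gt0// lt_def enorm_ge0 ?x0 ?y0.
rewrite -(ler_pM2l xy) -subr_ge0.
(* The gap in the inequality, times [2 * (enorm x * enorm y)], is a sum of squares. *)
have /eqP : \sum_(i < d) (enorm y * x i 0 - enorm x * y i 0) ^+ 2 =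
    2 * (enorm x * enorm y * (enorm x * enorm y) -
         enorm x * enorm y * \sum_(i < d) x i 0 * y i 0).
  rewrite mulrBr; transitivity (enorm y ^+ 2 * enorm x ^+ 2
      + enorm x ^+ 2 * enorm y ^+ 2
      - 2 * (enorm x * enorm y * \sum_(i < d) x i 0 * y i 0)); last by ring.
  rewrite {1}[enorm x ^+ 2]sqr_enorm {2}[enorm y ^+ 2]sqr_enorm !mulr_sumr.
  rewrite -sumrN -!big_split/=; apply: eq_bigr => i _; ring.
move=> /eqP E; rewrite -(pmulr_rge0 _ (ltr0n R 2)) -E sumr_ge0// => i _.
exact: sqr_ge0.
Qed.

Lemma ler_enormD x y : enorm (x + y) <= enorm x + enorm y.
Proof.
rewrite -(ler_pXn2r (n := 2))// ?nnegrE ?addr_ge0 ?enorm_ge0//.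
rewrite sqrrD !sqr_enorm -mulr_natl.
under eq_bigr do rewrite mxE sqrrD.
rewrite !big_split/=.
by rewrite lerD2r lerD2l -mulr2n -[leLHS]mulr_natl ler_pM2l// cauchy_schwarz.
Qed.

Lemma ler_enorm_dist x y z : enorm (x - z) <= enorm (x - y) + enorm (y - z).
Proof. by apply: le_trans (ler_enormD _ _); rewrite addrA subrK. Qed.

Lemma enorm_orthogonal O x : orthogonal_mx O -> enorm (O *m x) = enorm x.
Proof.
move=> /mulmx1C OO; congr Num.sqrt.
have H y : \sum_(i < d) y i 0 ^+ 2 = (y^T *m y) 0 0.
  by rewrite mxE; apply: eq_bigr => i _; rewrite mxE.
by rewrite !H trmx_mul mulmxA -(mulmxA x^T) OO mulmx1.
Qed.

Lemma normr_le_enorm x : `|x| <= enorm x.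
Proof.
rewrite /Num.norm/= mx_normrE; apply: bigmax_le => [|[i j] _]; first exact: enorm_ge0.
by rewrite ord1/= ler_coord_enorm.
Qed.

Lemma enorm_le_normr x : enorm x <= d%:R * `|x|.
Proof.
have dx : 0 <= d%:R * `|x| by rewrite mulr_ge0.
rewrite -(ler_pXn2r (n := 2))// ?nnegrE ?enorm_ge0// sqr_enorm.
have H i : x i 0 ^+ 2 <= `|x| ^+ 2.
  rewrite -real_normK ?num_real// ler_pXn2r ?nnegrE//.
  rewrite [X in _ <= X]/Num.norm/= mx_normrE.
  exact: (le_bigmax _ (fun ij => `|x ij.1 ij.2|) (i, 0)).
apply: (@le_trans _ _ (\sum_(i < d) `|x| ^+ 2)); first exact: ler_sum.
rewrite sumr_const card_ord -[leLHS]mulr_natl exprMn ler_wpM2r ?sqr_ge0//.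
by case: {+}d => [|n]; rewrite ?expr0n// -natrX ler_nat -mulnn leq_pmulr.
Qed.

Lemma nbhs_enorm x (P : set 'cV[R]_d) :
  nbhs x P <-> exists2 e : R, 0 < e & forall y, enorm (x - y) < e -> P y.
Proof.
split.
  move=> /nbhs_ballP[e/= e0 xP]; exists e => // y xy; apply: xP.
  by rewrite -ball_normE/=; apply: le_lt_trans xy; exact: normr_le_enorm.
(* Dividing by [d.+1] instead of [d] keeps the radius positive when [d = 0]. *)
move=> [e e0 xP]; apply/nbhs_ballP; exists (e / d.+1%:R) => /=.
  by rewrite divr_gt0.
move=> y; rewrite -ball_normE/= => xy; apply: xP.
apply: le_lt_trans (enorm_le_normr _) _.
rewrite ltr_pdivlMr// mulrC in xy; apply: le_lt_trans xy.
by rewrite ler_wpM2r// ler_nat.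
Qed.

Lemma closure_enorm A x : closure A x <->
  forall e : R, 0 < e -> exists2 y, A y & enorm (x - y) < e.
Proof.
split.
  move=> Ax e e0; have [|y [Ay xy]] := Ax [set y | enorm (x - y) < e].
    by apply/nbhs_enorm; exists e.
  by exists y.
move=> H B /nbhs_enorm[e e0 xB]; have [y Ay xy] := H e e0.
by exists y; split => //; exact: xB.
Qed.

Lemma compact_enorm_bounded A : compact A ->
  exists2 C : R, 0 < C & forall x, A x -> enorm x <= C.
Proof.
move=> /compact_bounded[M [_ AM]].
exists (d.+1%:R * (`|M| + 1)); first by rewrite mulr_gt0// ltr_wpDl.
move=> x Ax; apply: le_trans (enorm_le_normr _) _.
apply: ler_pM => //; first by rewrite ler_nat.
by apply: AM => //; rewrite (le_lt_trans (ler_norm M))// ltrDl.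
Qed.

End EuclideanNorm.

(** * Finite packings and packing dimension *)

Section FinitePackings.
Context {R : realType} {d : nat}.
Implicit Types (x y z c : 'cV[R]_d) (E F : set 'cV[R]_d) (s t delta : R).

(* With [k = 1] these are the finite packings; with [k > 1] the centres can be
   moved a little without making the balls meet. *)
Definition finite_packing (k delta : R) E (p : seq ('cV[R]_d * R)) : Prop :=
  [/\ uniq p,
      forall b, b \in p -> E b.1,
      forall b, b \in p -> 0 < b.2 <= delta &
      forall b b', b \in p -> b' \in p -> b != b' ->
        k * (b.2 + b'.2) < enorm (b.1 - b'.1)].

Definition ball_sum s (p : seq ('cV[R]_d * R)) : R :=
  \sum_(b <- p) (2 * b.2) `^ s.

(** Disjointness of balls becomes an inequality between centres. For the converse, the point
    dividing the segment from [x] to [y] in the ratio [r : t] lies in both balls. *)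
Lemma eclosed_ball_meet x y r t : 0 < r -> 0 < t ->
  (eclosed_ball x r `&` eclosed_ball y t !=set0) <-> (enorm (x - y) <= r + t).
Proof.
move=> r0 t0; split=> [[z [/= zx zy]]|xy].
  by rewrite (le_trans (ler_enorm_dist x z y))// lerD// enormB.
have rt0 : 0 < r + t by rewrite addr_gt0.
exists (x - (r / (r + t)) *: (x - y)); split; rewrite /eclosed_ball/=.
  rewrite addrAC subrr sub0r enormN enormZ ger0_norm; last exact/ltW/divr_gt0.
  by rewrite mulrAC ler_pdivrMr// ler_pM2l.
have -> : x - (r / (r + t)) *: (x - y) - y = (t / (r + t)) *: (x - y).
  rewrite addrAC -[X in X - _]scale1r -scalerBl; congr (_ *: _).
  by field; rewrite gt_eqF.
rewrite enormZ ger0_norm; last exact/ltW/divr_gt0.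
by rewrite mulrAC ler_pdivrMr// ler_pM2l.
Qed.

Lemma ball_sum_le_packing_size s delta E p :
  finite_packing 1 delta E p -> ((ball_sum s p)%:E <= packing_size s delta E)%E.
Proof.
move=> [Up pE pr psep]; apply: ereal_sup_ubound.
exists [set` p].
  split; [exact: pE|exact: pr|].
  move=> b b' /= bp b'p /eclosed_ball_meet.
  have [/pr/andP[b0 _] /pr/andP[b'0 _]] := (bp, b'p).
  move=> /(_ b0 b'0); apply: contraTeq => /psep => /(_ bp b'p).
  by rewrite mul1r -ltNge.
rewrite esum_fset; first by rewrite -fsbig_seq// sumEFin.
  exact: finite_seq.
by move=> b _; rewrite lee_fin powR_ge0.
Qed.

(** The sum over an arbitrary packing is the supremum of its finite subsums, and a subfamily of a
    packing is a packing. *)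
Lemma lt_packing_size s delta E (L : \bar R) : (L < packing_size s delta E)%E ->
  exists2 p, finite_packing 1 delta E p & (L < (ball_sum s p)%:E)%E.
Proof.
move=> /ereal_sup_gt[_ [B [BE Br Bsep] <-]] /ereal_sup_gt[_ [A [finA AB] <-]].
rewrite fsbig_finite//= sumEFin => LA; exists (finmap.enum_fset (fset_set A)) => //.
have memA b : b \in finmap.enum_fset (fset_set A) -> B b.
  by move=> bA; apply: AB; move: bA; rewrite in_fset_set// inE.
split; [exact: finmap.fset_uniq|by move=> b /memA/BE|by move=> b /memA/Br|].
move=> b b' /memA Bb /memA Bb' bb'; rewrite mul1r ltNge.
have [/andP[b0 _] /andP[b'0 _]] := (Br _ Bb, Br _ Bb').
apply/negP => /eclosed_ball_meet-/(_ b0 b'0) /(Bsep _ _ Bb Bb') /eqP.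
exact/negP.
Qed.

Lemma packing_size_ge0 s delta E : (0 <= packing_size s delta E)%E.
Proof.
have : finite_packing 1 delta E [::] by split.
by move=> /(ball_sum_le_packing_size s); rewrite /ball_sum big_nil.
Qed.

Lemma packing_premeasure_ge0 s E : (0 <= packing_premeasure s E)%E.
Proof. by apply: le_ereal_inf_tmp => _ [delta _ <-]; exact: packing_size_ge0. Qed.

Lemma packing_measure_ge0 s E : (0 <= packing_measure s E)%E.
Proof.
apply: le_ereal_inf_tmp => _ [F _ <-]; apply: nneseries_ge0 => n _ _.
exact: packing_premeasure_ge0.
Qed.

Lemma packing_size_translate s delta c E F :
  (forall x, E x -> F (x + c)) ->
  (packing_size s delta E <= packing_size s delta F)%E.
Proof.
move=> EF; rewrite leNgt; apply/negP => /lt_packing_size[p [Up pE pr psep]].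
have inj : injective (fun b : 'cV[R]_d * R => (b.1 + c, b.2)).
  by move=> [x r] [y t] [/addIr -> ->].
have : finite_packing 1 delta F [seq (b.1 + c, b.2) | b <- p].
  split.
  - by rewrite map_inj_uniq.
  - by move=> _ /mapP[b bp ->]; apply: EF; exact: pE.
  - by move=> _ /mapP[b bp ->] /=; exact: pr.
  - move=> _ _ /mapP[b bp ->] /mapP[b' b'p ->] bb'.
    rewrite /= opprD addrACA subrr addr0; apply: psep => //.
    by move: bb'; apply: contra_neq => ->.
move=> /(ball_sum_le_packing_size s); rewrite /ball_sum big_map.
by rewrite leNgt => /negP.
Qed.

Lemma packing_measure_translate s c E F :
  (forall x, E x -> F (x + c)) -> (packing_measure s E <= packing_measure s F)%E.
Proof.
move=> EF; apply: le_ereal_inf_tmp => _ [G FG <-]; apply: ge_ereal_inf.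
pose G' n := [set x | G n (x + c)].
exists (\sum_(0 <= n <oo) packing_premeasure s (G' n))%E.
  by exists G' => // x /EF/FG[n _ Gn]; exists n.
apply: lee_nneseries => [n _ _|n _]; first exact: packing_premeasure_ge0.
apply: le_ereal_inf_tmp => _ [delta delta0 <-]; apply: ge_ereal_inf.
exists (packing_size s delta (G' n)); first by exists delta.
by apply: (packing_size_translate s delta c) => x.
Qed.

(** With [c = 0] this is monotonicity; applied with [c] and [- c] it gives translation
    invariance. *)
Lemma packing_dim_translate c E F :
  (forall x, E x -> F (x + c)) -> (packing_dim E <= packing_dim F)%E.
Proof.
move=> EF; apply: le_ereal_inf_tmp => _ [s [s0 Fs] <-].
apply: ereal_inf_lbound; exists s => //; split=> //; apply/eqP.
by rewrite eq_le packing_measure_ge0 -Fs (packing_measure_translate _ _ _ _ EF).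
Qed.

Lemma packing_dim_le s E :
  0 <= s -> packing_measure s E = 0%E -> (packing_dim E <= s%:E)%E.
Proof. by move=> s0 Es; apply: ereal_inf_lbound; exists s. Qed.

(* The balls of radius at most [delta] satisfy
   [(2 r)^t <= (2 delta)^(t - s) (2 r)^s], so that a bound on the [s]-sums of
   packings forces the [t]-dimensional premeasure to vanish. *)
Lemma large_packing s E (L delta : R) :
  0 <= s -> (s%:E < packing_dim E)%E -> 0 < delta ->
  exists2 p, finite_packing 1 delta E p & L < ball_sum s p.
Proof.
move=> s0 sE delta0.
suff : (L%:E < packing_size s delta E)%E by move=> /lt_packing_size.
rewrite ltNge; apply/negP => EL.
(* The [t]-dimensional measure will be shown to vanish, which contradicts the choice of [t] below
   the dimension. *)
have {sE} [t st tE] : exists2 t : R, s < t & (t%:E < packing_dim E)%E.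
  case: (packing_dim E) sE => [D|_|//].
    rewrite lte_fin => sD; exists ((s + D) / 2); first by rewrite midf_lt.
    by rewrite lte_fin midf_lt.
  by exists (s + 1); rewrite ?ltrDl// ltry.
have t0 : 0 <= t by rewrite (le_trans s0)// ltW.
have L0 : 0 <= L by rewrite -lee_fin (le_trans _ EL)// packing_size_ge0.
have premeasure0 : packing_premeasure t E = 0%E.
  apply/eqP; rewrite eq_le packing_premeasure_ge0 andbT.
  apply/lee_addgt0Pr => e e0; rewrite add0e; apply: ge_ereal_inf.
  (* The second term makes the power [t - s] of [2 * eta] at most [e / (L + 1)]; the [+ 1] covers
     [L = 0]. *)
  pose eta := Num.min delta ((e / (L + 1)) `^ (t - s)^-1 / 2).
  have eta0 : 0 < eta 
    by rewrite lt_min delta0 divr_gt0// powR_gt0// divr_gt0// ltr_wpDl.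
  exists (packing_size t eta E); first by exists eta.
  rewrite leNgt; apply/negP => /lt_packing_size[p [Up pE pr psep]].
  have pr' b : b \in p -> 0 < b.2 <= delta.
    by move=> /pr/andP[-> /le_trans]; apply; rewrite ge_min lexx.
  have := ball_sum_le_packing_size s delta E p (And4 Up pE pr' psep).
  move=> /le_trans/(_ EL); rewrite lee_fin lte_fin => pL; apply/negP.
  rewrite -leNgt.
  apply: (@le_trans _ _ ((e / (L + 1)) * ball_sum s p)); last first.
    rewrite mulrAC ler_pdivrMr ?ltr_wpDl// ler_pM2l// (le_trans pL)//.
    by rewrite lerDl.
  rewrite mulr_sumr /ball_sum big_seq [leRHS]big_seq; apply: ler_sum => b bp.
  have /andP[b0 beta] := pr _ bp.
  rewrite -[t in leLHS](subrK s) powRD; last first.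
    by apply/implyP => _; rewrite gt_eqF// mulr_gt0.
  rewrite ler_wpM2r ?powR_ge0//.
  apply: (@le_trans _ _ (((e / (L + 1)) `^ (t - s)^-1) `^ (t - s))); last first.
    rewrite -powRrM mulVf; first by rewrite powRr1// divr_ge0 ?addr_ge0// ltW.
    by rewrite gt_eqF// subr_gt0.
  apply: ge0_ler_powR; rewrite ?nnegrE ?powR_ge0 ?subr_ge0//; first exact: ltW.
    by rewrite mulr_ge0// ltW.
  by rewrite mulrC -ler_pdivlMr// (le_trans beta)// ge_min lexx orbT.
suff /(packing_dim_le t E t0) : packing_measure t E = 0%E by rewrite leNgt tE.
apply/eqP; rewrite eq_le packing_measure_ge0 andbT; apply: ereal_inf_lbound.
exists (fun=> E); first by move=> x Ex; exists 0%N.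
by rewrite eseries0.
Qed.

End FinitePackings.

(** * Allocation of blocks of positions *)

(* The points [x : T] are served in the order of their codes, each by an
   interval of positions starting after all the intervals used so far. *)
Lemma block_schedule (T : countType) (I : Type) (i0 : I) (owner : T -> I)
    (P : T -> nat -> nat -> Prop) :
  (forall x a0, exists a b, [/\ (a0 <= a)%N, (a <= b)%N & P x a b]) ->
  exists own : nat -> I, forall x, exists a b,
    [/\ (a <= b)%N, P x a b & forall n, (a <= n < b)%N -> own n = owner x].
Proof.
move=> exP.
have /choice[g gP] (xa : T * nat) : exists ab : nat * nat,
    [/\ (xa.2 <= ab.1)%N, (ab.1 <= ab.2)%N & P xa.1 ab.1 ab.2].
  by have [a [b abP]] := exP xa.1 xa.2; exists (a, b).
(* All blocks served for codes below [k] end at or before [e k]. *)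
pose e := fix e k := if k is k'.+1 then
  (if unpickle k' is Some x then (g (x, e k')).2 else e k') else 0%N.
have e_homo : {homo e : m n / (m <= n)%N}.
  apply: homo_leq => [//|m n p|k /=]; first exact: leq_trans.
  by case: (unpickle k) => // x; have [eg gg _] := gP (x, e k); exact: leq_trans eg gg.
pose a x := (g (x, e (pickle x))).1.
have e_pickle x : e (pickle x).+1 = (g (x, e (pickle x))).2 by rewrite /= pickleK.
(* Used in both directions, this shows that a position lies in at most one block. *)
have block_le x y n : (a x <= n < e (pickle x).+1)%N ->
    (a y <= n < e (pickle y).+1)%N -> (pickle y <= pickle x)%N.
  move=> /andP[_ nx] /andP[ny _]; rewrite leqNgt; apply/negP => /e_homo xy.
  have [ey _ _] := gP (y, e (pickle y)).
  by have := leq_trans (leq_trans nx (leq_trans xy ey)) ny; rewrite ltnn.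
(* Positions outside every block go to the default owner [i0]. *)
pose own n := match pselect (exists x, (a x <= n < e (pickle x).+1)%N) with
  | left ex => owner (projT1 (cid ex)) | right _ => i0 end.
exists own => x; exists (a x), (e (pickle x).+1).
have [_ ab abP] := gP (x, e (pickle x)).
rewrite e_pickle; split=> // n; rewrite -e_pickle /own => nx.
case: pselect => [ex|[]]; last by exists x.
case: (cid ex) => y /= ny; congr owner; apply: (pcan_inj pickleK).
by apply/eqP; rewrite eqn_leq (block_le x y n)// (block_le y x n).
Qed.

(** * Baire category argument *)

(** Otherwise there are nested balls centred in [T], the one of index [n.+1] missing [F n]; a
    cluster point of the centres lies in [closure T] but in no [F n]. The [F n] are arbitrary sets,
    hence a conclusion by approximation. *)
Lemma baire_closure {R : realType} {d : nat} (T : set 'cV[R]_d)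
    (F : nat -> set 'cV[R]_d) :
  T !=set0 -> compact (closure T) -> closure T `<=` \bigcup_n F n ->
  exists n x (e : R), [/\ T x, 0 < e & forall y, T y -> enorm (y - x) < e ->
    forall eta : R, 0 < eta -> exists2 z, F n z & enorm (z - y) < eta].
Proof.
move=> [x0 Tx0] cptT TF; apply: contrapT => noball.
have /choice[g gP] (nxe : nat * 'cV[R]_d * R) : exists xe : 'cV[R]_d * R,
    T nxe.1.2 -> 0 < nxe.2 ->
    [/\ T xe.1, 0 < xe.2, enorm (xe.1 - nxe.1.2) + xe.2 <= nxe.2 &
      forall z, F nxe.1.1 z -> xe.2 < enorm (z - xe.1)].
  move: nxe => [[n x] e]/=.
  have [Tx|] := pselect (T x); last by exists (x, e).
  have [e0|] := pselect (0 < e); last by exists (x, e).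
  apply: contrapT => H; apply: noball; exists n, x, e; split=> // y Ty yx eta eta0.
  apply: contrapT => Fy; apply: H.
  (* No point of [F n] is within [eta] of [y], so [eta / 2] keeps the closed ball off [F n]; the
     other term keeps it inside the previous ball. *)
  exists (y, Num.min (eta / 2) (e - enorm (y - x))) => /= _ _; split=> //.
  - by rewrite lt_min divr_gt0// subr_gt0.
  - by rewrite -lerBrDl ge_min lexx orbT.
  - move=> z Fz; rewrite gt_min; apply/orP; left; rewrite ltNge; apply/negP => zy.
    by apply: Fy; exists z => //; rewrite (le_lt_trans zy)// ltr_pdivrMr// ltr_pMr// ltr1n.
pose u := fix u n : 'cV[R]_d * R :=
  if n is m.+1 then g (m, (u m).1, (u m).2) else (x0, 1).
have uP n : T (u n).1 /\ 0 < (u n).2.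
  by elim: n => [//|n [Tn en]]; have [] := gP (n, (u n).1, (u n).2) Tn en.
have uS n : enorm ((u n.+1).1 - (u n).1) + (u n.+1).2 <= (u n).2 /\
    forall z, F n z -> (u n.+1).2 < enorm (z - (u n.+1).1).
  by have [Tn en] := uP n; have [] := gP (n, (u n).1, (u n).2) Tn en.
have nested n k : enorm ((u (k + n)%N).1 - (u n).1) + (u (k + n)%N).2 <= (u n).2.
  elim: k => [|k IH]; first by rewrite add0n subrr enorm0 add0r.
  apply: le_trans IH; rewrite addSn; have [+ _] := uS (k + n)%N.
  have := ler_enorm_dist (u (k + n).+1).1 (u (k + n)%N).1 (u n).1; lra.
have [|x [Tx xcl]] := cptT ((fun n => (u n).1) @ \oo) _.
  by exists 0%N => // n _; apply: subset_closure; have [] := uP n.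
have xball n : enorm (x - (u n).1) <= (u n).2.
  apply/ler_addgt0Pr => e e0.
  have [||_ [[m /= mn <-] xy]] := xcl [set (u m).1 | m in [set m | (n <= m)%N]]
      [set y | enorm (x - y) < e].
  - by exists n => // m nm; exists m.
  - by apply/nbhs_enorm; exists e.
  - have := nested n (m - n)%N; rewrite subnK//.
    have := ler_enorm_dist x (u m).1 (u n).1; have [_] := uP m; move: xy => /=; lra.
have [n _ Fnx] := TF x Tx.
have [_ /(_ x Fnx)] := uS n.
by rewrite ltNge xball.
Qed.

(** * Digit expansions *)

Section DigitExpansions.
Context {R : realType} {d : nat} (A : 'M[R]_d).
Implicit Types (u w : nat -> 'cV[R]_d) (D K : set 'cV[R]_d).

Definition digit_sum u n : 'cV[R]_d := \sum_(k < n) A ^+ k *m u k.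

Lemma digit_sumS u n :
  digit_sum u n.+1 = u 0%N + A *m digit_sum (fun k => u k.+1) n.
Proof.
rewrite /digit_sum big_ord_recl expr0 mul1mx mulmx_sumr; congr (_ + _).
by apply: eq_bigr => k _; rewrite mulmxA exprS.
Qed.

Lemma digit_sumD u a n :
  digit_sum u (a + n) = digit_sum u a + A ^+ a *m digit_sum (fun k => u (a + k)%N) n.
Proof.
rewrite /digit_sum big_split_ord/= mulmx_sumr; congr (_ + _).
by apply: eq_bigr => k _; rewrite mulmxA exprD.
Qed.

Lemma eq_digit_sum u w n :
  (forall k, (k < n)%N -> u k = w k) -> digit_sum u n = digit_sum w n.
Proof. by move=> uw; apply: eq_bigr => k _; rewrite uw. Qed.

Lemma digit_sum_pad u n m : (n <= m)%N -> (forall k, (n <= k)%N -> u k = 0) ->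
  digit_sum u m = digit_sum u n.
Proof.
move=> /subnKC <- u0; rewrite digit_sumD [X in _ *m X]big1 ?mulmx0 ?addr0//.
by move=> k _; rewrite u0 ?leq_addr// mulmx0.
Qed.

Lemma enorm_expmx (rho : R) : 0 <= rho ->
  (forall x : 'cV[R]_d, enorm (A *m x) = rho * enorm x) ->
  forall n (x : 'cV[R]_d), enorm (A ^+ n *m x) = rho ^+ n * enorm x.
Proof.
move=> rho0 HA; elim=> [|n IH] x; first by rewrite !expr0 mul1mx mul1r.
by rewrite !exprS -mulrA -IH -HA mulmxA.
Qed.

Lemma digit_sum_in D K :
  (forall x t, K x -> D t -> K (A *m x + t)) ->
  forall n u y, (forall k, D (u k)) -> K y -> K (digit_sum u n + A ^+ n *m y).
Proof.
move=> KD; elim=> [|n IH] u y Du Ky.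
  by rewrite /digit_sum big_ord0 expr0 mul1mx add0r.
rewrite digit_sumS exprS -addrA.
have -> : (A * A ^+ n) *m y = A *m (A ^+ n *m y) by rewrite mulmxA.
by rewrite -mulmxDr addrC; apply: KD => //; apply: IH.
Qed.

Lemma digit_expansion D K :
  (forall x, K x -> exists y t, [/\ K y, D t & x = A *m y + t]) ->
  forall n x, K x -> exists u y,
    [/\ forall k, D (u k), K y & x = digit_sum u n + A ^+ n *m y].
Proof.
move=> KD; elim=> [|n IH] x Kx; have [y [t [Ky Dt xE]]] := KD x Kx.
  (* Even for length 0 a whole sequence in [D] must be given; the digit [t] of [x] supplies one. *)
  exists (fun=> t), x; split=> //.
  by rewrite /digit_sum big_ord0 expr0 mul1mx add0r.
have [u [z [Du Kz yE]]] := IH y Ky.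
exists (fun k => if k is k'.+1 then u k' else t), z; split=> //; first by case.
rewrite xE yE digit_sumS exprS -addrA [in LHS]addrC mulmxDr.
by congr (_ + (_ + _)); rewrite mulmxA.
Qed.

End DigitExpansions.

(** * Packings carried by blocks of digits, and their perturbation *)

(* A finite packing of [K] with a large [s]-sum stays one when its centres are
   replaced by long enough finite digit sums; it is then scaled by [A ^+ a] to
   live in the positions from [a] on. *)
Lemma block_packing {R : realType} {d : nat} (A : 'M[R]_d) (rho s : R)
    (D K : set 'cV[R]_d) (N a : nat) :
  0 < rho < 1 -> (forall x : 'cV[R]_d, enorm (A *m x) = rho * enorm x) ->
  compact K ->
  (forall x, K x -> exists y t, [/\ K y, D t & x = A *m y + t]) ->
  0 <= s -> (s%:E < packing_dim K)%E ->
  exists n p,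
    finite_packing 2 (N.+2%:R^-1)
      [set x | exists2 u, forall k, D (u k) & x = A ^+ a *m digit_sum A u n] p /\
    N%:R <= ball_sum s p.
Proof.
move=> /andP[rho0 rho1] HA cptK KD s0 sK.
have HAn := enorm_expmx A rho (ltW rho0) HA.
have [C C0 KC] := compact_enorm_bounded K cptK.
(* Moving each centre by a quarter of its radius leaves more than 3/4 of the sum of the radii
   between two centres. Shrinking the radii by a further factor 4 makes the required separation only
   1/2 of that sum. *)
pose c : R := rho ^+ a / 4.
have c0 : 0 < c by rewrite divr_gt0// exprn_gt0.
have delta0 : 0 < N.+2%:R^-1 / c by rewrite divr_gt0// invr_gt0.
(* The threshold and the radius bound are divided by what the scaling by [c] will multiply them
   by. *)
have [p [Up pK pr psep] Lp] := large_packing s K (N%:R / c `^ s) _ s0 sK delta0.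
(* The packing is finite, so a single length [n] makes the remainder of the expansion small against
   every radius. *)
have [n nP] : exists n, forall b, b \in p -> rho ^+ n * C < b.2 / 4.
  have b0 b : b \in p -> 0 < b.2 by move=> /pr/andP[].
  have : forall b, b \in p -> exists n, forall m, (n <= m)%N -> rho ^+ m * C < b.2 / 4.
    move=> b /b0 bgt0; have : `|rho| < 1 by rewrite gtr0_norm.
    move=> /cvg_expr/cvgr0Pnorm_lt/(_ (b.2 / 4 / C))[|n _ nb].
      by rewrite !divr_gt0.
    exists n => m /nb; rewrite /= gtr0_norm ?exprn_gt0// => mb.
    by rewrite -ltr_pdivlMr.
  elim: (p) => [|b q IH] H; first by exists 0%N.
  have [n nq] : exists n, forall b, b \in q -> rho ^+ n * C < b.2 / 4.
    by apply: IH => b' b'q; apply: H; rewrite inE b'q orbT.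
  have [m mb] := H b (mem_head _ _); exists (maxn m n) => b'; rewrite inE.
  move=> /predU1P[->|/nq]; first exact/mb/leq_maxl.
  apply: le_lt_trans; rewrite ler_pM2r//.
  by rewrite ler_wiXn2l ?leq_maxr// ltW.
have /choice[u uP] (b : 'cV[R]_d * R) : exists u, b \in p ->
    (forall k, D (u k)) /\ enorm (b.1 - digit_sum A u n) < b.2 / 4.
  have [bp|_] := boolP (b \in p); last by exists (fun=> 0).
  have [u [y [Du Ky E]]] := digit_expansion A D K KD n b.1 (pK b bp).
  exists u => _; split=> //; rewrite E addrAC subrr add0r HAn.
  by apply: le_lt_trans (nP b bp); rewrite ler_wpM2l ?exprn_ge0 ?KC// ltW.
pose f (b : 'cV[R]_d * R) := (A ^+ a *m digit_sum A (u b) n, c * b.2).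
have sepf b b' : b \in p -> b' \in p -> b != b' ->
    2 * ((f b).2 + (f b').2) < enorm ((f b).1 - (f b').1).
  move=> bp b'p bb' /=; rewrite -mulmxBr HAn.
  have -> : 2 * (c * b.2 + c * b'.2) = rho ^+ a * ((b.2 + b'.2) / 2).
    by rewrite /c; field.
  rewrite ltr_pM2l ?exprn_gt0//; have [_ ub] := uP b bp; have [_ ub'] := uP b' b'p.
  have := psep b b' bp b'p bb'.
  have := ler_enorm_dist b.1 (digit_sum A (u b) n) b'.1.
  have := ler_enorm_dist (digit_sum A (u b) n) (digit_sum A (u b') n) b'.1.
  move: (pr b bp) (pr b' b'p) ub ub'; rewrite [X in _ -> _ -> _ -> X < _ -> _]enormB.
  by move=> /andP[+ _] /andP[+ _]; lra.
have fr b : b \in p -> 0 < (f b).2 <= N.+2%:R^-1.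
  move=> /pr/andP[b0 bN] /=; rewrite mulr_gt0//=.
  by rewrite mulrC -ler_pdivlMr.
exists n, (map f p); split; first split.
- rewrite map_inj_in_uniq// => b b' bp b'p bb'; apply/eqP; apply: contraT => neq.
  have := sepf b b' bp b'p neq; rewrite bb' subrr enorm0.
  by have /andP[] := fr b' b'p; lra.
- by move=> _ /mapP[b bp ->]; exists (u b) => //; have [] := uP b bp.
- by move=> _ /mapP[b bp ->]; exact: fr.
- move=> _ _ /mapP[b bp ->] /mapP[b' b'p ->] neq; apply: sepf => //.
  by move: neq; apply: contra_neq => ->.
have -> : ball_sum s (map f p) = c `^ s * ball_sum s p.
  rewrite /ball_sum big_map mulr_sumr !big_seq; apply: eq_bigr => b bp /=.
  have /andP[b0 _] := pr b bp.
  by rewrite mulrCA [LHS]powRM ?(ltW c0) ?mulr_ge0 ?(ltW b0).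
by rewrite mulrC -ler_pdivrMr ?powR_gt0//; exact: ltW.
Qed.

(** Each centre moves by less than half its radius, so a separation of twice the sum of the radii
    drops to no less than 3/2 of it, and the balls stay disjoint with unchanged radii. *)
Lemma perturbed_packing {R : realType} {d : nat} (delta s : R)
    (E F : set 'cV[R]_d) (p : seq ('cV[R]_d * R)) (x : 'cV[R]_d) :
  finite_packing 2 delta E p ->
  (forall b, b \in p -> exists2 z, F z & enorm (z - (x + b.1)) < b.2 / 2) ->
  ((ball_sum s p)%:E <= packing_size s delta F)%E.
Proof.
move=> [Up pE pr psep] H.
have /choice[z zP] (b : 'cV[R]_d * R) : exists z, b \in p ->
    F z /\ enorm (z - (x + b.1)) < b.2 / 2.
  have [/H[z Fz zb]|_] := boolP (b \in p); first by exists z.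
  by exists 0.
have sepz b b' : b \in p -> b' \in p -> b != b' ->
    b.2 + b'.2 < enorm (z b - z b').
  move=> bp b'p bb'; have := psep b b' bp b'p bb'.
  have [_ zb] := zP b bp; have [_ zb'] := zP b' b'p.
  have := ler_enorm_dist (x + b.1) (z b) (x + b'.1).
  have := ler_enorm_dist (z b) (z b') (x + b'.1).
  have -> : x + b.1 - (x + b'.1) = b.1 - b'.1 by rewrite opprD addrACA subrr add0r.
  rewrite (enormB (x + b.1)).
  by move: (pr b bp) (pr b' b'p) => /andP[+ _] /andP[+ _]; lra.
have : finite_packing 1 delta F [seq (z b, b.2) | b <- p].
  split.
  - rewrite map_inj_in_uniq// => b b' bp b'p [zz rr]; apply/eqP/contraT => neq.
    have := sepz b b' bp b'p neq; rewrite zz subrr enorm0.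
    by move: (pr b bp) (pr b' b'p) => /andP[+ _] /andP[+ _]; lra.
  - by move=> _ /mapP[b bp ->]; have [] := zP b bp.
  - by move=> _ /mapP[b bp ->] /=; exact: pr.
  - move=> _ _ /mapP[b bp ->] /mapP[b' b'p ->] neq; rewrite mul1r/=.
    by apply: sepz => //; move: neq; apply: contra_neq => ->.
by move=> /(ball_sum_le_packing_size s); rewrite {1}/ball_sum big_map.
Qed.

(** * Splitting the digit positions among the summands *)

Section Splitting.
Context {R : realType} {d : nat} (A : 'M[R]_d) (rho : R) (D K : set 'cV[R]_d).
Context (rho01 : 0 < rho < 1)
  (HA : forall x : 'cV[R]_d, enorm (A *m x) = rho * enorm x)
  (cptK : compact K) (K0 : K 0) (D0 : D 0)
  (DK : forall x t, K x -> D t -> K (A *m x + t))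
  (KD : forall x, K x -> exists y t, [/\ K y, D t & x = A *m y + t]).

Lemma digit_sum_mem n u : (forall k, D (u k)) -> K (digit_sum A u n).
Proof.
by move=> Du; have := digit_sum_in A D K DK n u 0 Du K0; rewrite mulmx0 addr0.
Qed.

(** Letting [u] vanish from [n] on allows sums to be padded to a common length and later blocks to
    be filled in. *)
Definition partial_sums {I : eqType} (own : nat -> I) (i : I) : set 'cV[R]_d :=
  [set x | exists n u, [/\ forall k, D (u k), forall k, own k != i -> u k = 0,
     forall k, (n <= k)%N -> u k = 0 & x = digit_sum A u n]].

Context {I : finType} (own : nat -> I).

Lemma partial_sums_mem i x : partial_sums own i x -> K x.
Proof. by move=> [n [u [Du _ _ ->]]]; exact: digit_sum_mem. Qed.

Lemma closure_partial_sums_sub i : closure (partial_sums own i) `<=` K.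
Proof.
have /closure_id -> : closed K.
  by apply: compact_closed => //; exact: norm_hausdorff.
by apply: closureS => x; exact: partial_sums_mem.
Qed.

Lemma compact_closure_partial_sums i : compact (closure (partial_sums own i)).
Proof.
apply: (subclosed_compact _ cptK); first exact: closed_closure.
exact: closure_partial_sums_sub.
Qed.

(** At position [k] only the summand [own k] can have a nonzero digit, so the digits add up to a
    single element of [D]. *)
Lemma sum_partial_sums (x : I -> 'cV[R]_d) :
  (forall i, partial_sums own i (x i)) -> K (\sum_i x i).
Proof.
move=> /choice[n] /choice[u uP].
pose m := (\sum_i n i)%N.
have -> : \sum_i x i = digit_sum A (fun k => \sum_i u i k) m.
  rewrite /digit_sum; under [RHS]eq_bigr do rewrite mulmx_sumr.
  rewrite exchange_big; apply: eq_bigr => i _.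
  have [_ _ u0 ->] := uP i; rewrite -(@digit_sum_pad _ _ _ _ _ m)//.
  by rewrite /m (bigD1 i)//= leq_addr.
apply: digit_sum_mem => k; rewrite (bigD1 (own k))//= big1 ?addr0.
  by have [] := uP (own k).
by move=> i; rewrite eq_sym => ki; have [_ ->] := uP i.
Qed.

Lemma sum_closure_partial_sums (x : I -> 'cV[R]_d) :
  (forall i, closure (partial_sums own i) (x i)) -> K (\sum_i x i).
Proof.
move=> Tx; apply: (compact_closed _ cptK); first exact: norm_hausdorff.
apply/closure_enorm => e e0.
have e'0 : 0 < e / #|I|.+1%:R by rewrite divr_gt0.
have /choice[y yP] i : exists y, partial_sums own i y /\
    enorm (x i - y) < e / #|I|.+1%:R.
  by move: (Tx i) => /closure_enorm/(_ _ e'0)[y]; exists y.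
exists (\sum_i y i); first by apply: sum_partial_sums => i; have [] := yP i.
rewrite -sumrB; apply: (@le_lt_trans _ _ (\sum_(i in I) e / #|I|.+1%:R)).
  apply: (big_ind2 (fun v r => enorm v <= r)) => [|v r w r' vr wr'|i _].
  - by rewrite enorm0.
  - by rewrite (le_trans (ler_enormD _ _))// lerD.
  - by have [_ /ltW] := yP i.
rewrite sumr_const -[ltLHS]mulr_natl mulrCA gtr_pMr//.
by rewrite ltr_pdivrMr// mul1r ltr_nat.
Qed.

(** The bound by the inverse of [N.+2] tends to 0 and keeps every diameter at most 1, so that
    lowering the exponent can only increase the ball sum. *)
Definition rich_block (q : R) (N a b : nat) : Prop := exists2 p,
  finite_packing 2 (N.+2%:R^-1)
    [set x | exists2 u, forall k, D (u k) & x = A ^+ a *m digit_sum A u (b - a)] p &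
  N%:R <= ball_sum q p.

Lemma exists_rich_block (q : R) (N a : nat) : 0 <= q ->
  (q%:E < packing_dim K)%E -> exists2 b, (a <= b)%N & rich_block q N a b.
Proof.
move=> q0 qK.
have [n [p [pp Np]]] := block_packing A rho q D K N a rho01 HA cptK KD q0 qK.
by exists (a + n)%N; [exact: leq_addr|exists p; rewrite // addKn].
Qed.

Lemma packing_dim_closure_partial_sums i :
  (forall (q : rat) N, 0 <= ratr q :> R -> ((ratr q)%:E < packing_dim K)%E ->
    exists a b, [/\ (N <= a)%N, (a <= b)%N, rich_block (ratr q) N a b &
      forall n, (a <= n < b)%N -> own n = i]) ->
  packing_dim (closure (partial_sums own i)) = packing_dim K.
Proof.
move=> rich; apply/eqP; rewrite eq_le; apply/andP; split.
  apply: (packing_dim_translate 0) => x; rewrite addr0.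
  exact: closure_partial_sums_sub.
apply: le_ereal_inf_tmp => _ [s [s0 Ts] <-]; rewrite leNgt; apply/negP => sK.
(* Blocks are available for rational exponents only, which keeps the requests countable. *)
have {sK} [q sq qK] : exists2 q : rat, s < ratr q & ((ratr q)%:E < packing_dim K)%E.
  have [t st tK] : exists2 t : R, s < t & (t%:E <= packing_dim K)%E.
    case: (packing_dim K) sK => [r|_|//]; first by exists r.
    by exists (s + 1); rewrite ?ltrDl// leey.
  have [q] := rat_in_itvoo st; rewrite in_itv/= => /andP[sq qt].
  by exists q => //; apply: lt_le_trans tK; rewrite lte_fin.
have q0 : 0 <= ratr q :> R by rewrite (le_trans s0)// ltW.
have [_ [F TF <-] F1] : exists2 m, [set (\sum_(0 <= n <oo) packing_premeasure s (F n))%E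
    | F in [set F | closure (partial_sums own i) `<=` \bigcup_n F n]] m & (m < 1)%E.
  by apply: ereal_inf_lt; rewrite -/(packing_measure _ _) Ts.
have T0 : partial_sums own i !=set0.
  by exists 0, 0%N, (fun=> 0); split=> //; rewrite /digit_sum big_ord0.
have [n [x [e [[n0 [u [Du ui u0 xE]] e0 Fx]]]]] :=
  baire_closure _ F T0 (compact_closure_partial_sums i) TF.
(* The premeasures of the cover sum to less than 1, so one infinite term is a contradiction. *)
suff : packing_premeasure s (F n) = +oo%E.
  have : (packing_premeasure s (F n) < 1)%E.
    apply: le_lt_trans F1; apply: le_trans (nneseries_lim_ge n.+1 _).
      rewrite big_nat_recr//= leeDr// sume_ge0// => k _.
      exact: packing_premeasure_ge0.
    by move=> k _ _; exact: packing_premeasure_ge0.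
  by move=> + E; rewrite E.
apply/ereal_inf_pinfty => _ [delta delta0 <-] /=; apply/eqyP => M M0.
have [C C0 KC] := compact_enorm_bounded K cptK.
have HAn := enorm_expmx A rho (ltW (proj1 (andP rho01))) HA.
(* In order: the ball sum beats [M], the block starts after the digits of [x], the radii are at most
   [delta], and the block moves [x] by less than [e]. *)
have [N [NM Nn0 Nd NC]] : exists N,
    [/\ M <= N%:R, (n0 <= N)%N, N.+2%:R^-1 <= delta & rho ^+ N * C < e].
  near \oo => N; exists N; split.
  - near: N; exact: nbhs_infty_ger.
  - near: N; exact: nbhs_infty_ge.
  - apply: (@le_trans _ _ N.+1%:R^-1); first by rewrite lef_pV2 ?posrE// ler_nat.
    by apply: ltW; near: N; exact: (near_infty_natSinv_lt (PosNum delta0)).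
  - rewrite -ltr_pdivlMr//; apply: le_lt_trans (ler_norm _) _; near: N.
    have : `|rho| < 1 by rewrite gtr0_norm; case/andP: rho01.
    by move=> /cvg_expr/cvgr0Pnorm_lt; apply; rewrite divr_gt0.
have [a [b [Na ab [p pp Np] owni]]] := rich q N q0 qK.
have [Up pE pr psep] := pp.
apply: (@le_trans _ _ (ball_sum s p)%:E).
  rewrite lee_fin (le_trans NM)// (le_trans Np)// /ball_sum big_seq [leRHS]big_seq.
  apply: ler_sum => c cp; apply: ger_powR; last exact: ltW.
  have /andP[c0 cN] := pr c cp; rewrite mulr_gt0//= -ler_pdivlMl// mulr1.
  by rewrite (le_trans cN)// lef_pV2 ?posrE// ler_nat.
apply: (@le_trans _ _ (packing_size s N.+2%:R^-1 (F n))).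
  apply: (perturbed_packing _ _ _ _ _ x pp) => c cp.
  have /andP[c0 _] := pr c cp.
  have [v Dv cE] := pE c cp.
  apply: Fx; last by rewrite divr_gt0.
    (* The digits of [x] end before [a]; writing [v] into the block owned by [i] yields [x + c.1],
       again a partial sum for [i]. *)
    pose w k := if (a <= k < b)%N then v (k - a)%N else u k.
    exists b, w; rewrite /w; split.
    - by move=> k; case: ifP.
    - by move=> k ki; case: ifP => [/owni/eqP|_]; [rewrite (negbTE ki)|exact: ui].
    - move=> k bk; rewrite ltnNge bk andbF u0//.
      by rewrite (leq_trans Nn0)// (leq_trans Na)// (leq_trans ab).
    - rewrite cE -(subnKC ab) digit_sumD addKn; congr (_ + _).
        rewrite xE -(@digit_sum_pad _ _ _ _ _ a) ?(leq_trans Nn0)//.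
        by apply: eq_digit_sum => k ka; rewrite leqNgt ka.
      by congr (_ *m _); apply: eq_digit_sum => k; rewrite leq_addr/= ltn_add2l => ->; rewrite addKn.
  rewrite addrAC subrr add0r cE HAn; apply: le_lt_trans NC.
  apply: ler_pM; rewrite ?exprn_ge0 ?enorm_ge0//.
  - by case/andP: rho01 => /ltW.
  - by case/andP: rho01 => ? ?; rewrite ler_wiXn2l// ltW.
  - by apply: KC; exact: digit_sum_mem.
apply: ereal_sup_le => _ [B [BE Br Bsep] <-]; exists B => //; split=> // c /Br.
by move=> /andP[-> /le_trans]; apply.
Unshelve. all: by end_near.
Qed.

End Splitting.

Lemma sumset_splitting {R : realType} {d : nat} (A : 'M[R]_d) (rho : R)
    (D K : set 'cV[R]_d) (I : finType) (i0 : I) :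
  0 < rho < 1 -> (forall x : 'cV[R]_d, enorm (A *m x) = rho * enorm x) ->
  compact K -> K 0 -> D 0 ->
  (forall x t, K x -> D t -> K (A *m x + t)) ->
  (forall x, K x -> exists y t, [/\ K y, D t & x = A *m y + t]) ->
  exists B : I -> set 'cV[R]_d,
    [/\ forall i, compact (B i),
        forall x, (forall i, B i (x i)) -> K (\sum_i x i) &
        forall i, packing_dim (B i) = packing_dim K].
Proof.
move=> rho01 HA cptK K0 D0 DK KD.
(* A request names a summand, a rational exponent and a bound [N]; there are countably many. The
   implications let a request with an inadmissible exponent be met by an empty block. *)
pose P (x : I * rat * nat) a b := (x.2 <= a)%N /\
  (0 <= ratr x.1.2 :> R -> ((ratr x.1.2)%:E < packing_dim K)%E ->
    rich_block A D (ratr x.1.2) x.2 a b).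
have [|own ownP] := @block_schedule _ _ i0 (fun x : I * rat * nat => x.1.1) P.
  move=> [[i q] N] a0; pose a := maxn a0 N; rewrite /P/=.
  have [q0|nq0] := pselect (0 <= ratr q :> R); last first.
    by exists a, a; split=> //; rewrite ?leq_maxl// leq_maxr.
  have [qK|nqK] := pselect ((ratr q)%:E < packing_dim K)%E; last first.
    by exists a, a; split=> //; rewrite ?leq_maxl// leq_maxr.
  have [b ab rich] := exists_rich_block A rho D K rho01 HA cptK KD _ N a q0 qK.
  by exists a, b; split=> //; rewrite ?leq_maxl// leq_maxr.
exists (fun i => closure (partial_sums A D own i)); split.
- by move=> i; exact: (compact_closure_partial_sums A D K).
- by move=> x; exact: (sum_closure_partial_sums A D K).
- move=> i; apply: (packing_dim_closure_partial_sums A rho D K) => // q N q0 qK.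
  have [a [b [ab [Na rich] own_i]]] := ownP (i, q, N).
  by exists a, b; split=> //; exact: rich.
Qed.

(** * Reduction of the self-similar set to digit form *)

(** A vector fixed by the contraction [A] is 0, so [1%:M - A] is invertible and the fixed point
    exists. It lies in [K] as the limit of the iterates of a point of the closed set [K]. *)
Lemma affine_fixpoint {R : realType} {d : nat} (A : 'M[R]_d) (rho : R)
    (K : set 'cV[R]_d) (b : 'cV[R]_d) :
  0 < rho < 1 -> (forall x : 'cV[R]_d, enorm (A *m x) = rho * enorm x) ->
  compact K -> K !=set0 -> (forall x, K x -> K (A *m x + b)) ->
  exists2 p, K p & A *m p + b = p.
Proof.
move=> /andP[rho0 rho1] HA cptK [y Ky] Kb.
have unitA : 1%:M - A \in unitmx.
  rewrite -unitmx_tr -row_free_unit -kermx_eq0; apply/rowV0P => v.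
  move=> /sub_kermxP/(congr1 trmx); rewrite trmx_mul trmxK trmx0 mulmxBl mul1mx.
  move=> /eqP; rewrite subr_eq0 => /eqP vE.
  apply: trmx_inj; rewrite trmx0; apply: enorm_eq0.
  have /eqP := HA v^T; rewrite -vE eq_sym -subr_eq0 -{2}(mul1r (enorm _)) -mulrBl.
  by rewrite mulf_eq0 subr_eq0 lt_eqF//= => /eqP.
pose p := invmx (1%:M - A) *m b.
have pE : A *m p + b = p.
  have : (1%:M - A) *m p = b by rewrite mulKVmx.
  by rewrite mulmxBl mul1mx => /eqP; rewrite subr_eq addrC => /eqP <-.
exists p => //; apply: (compact_closed _ cptK); first exact: norm_hausdorff.
apply/closure_enorm => e e0.
have approx n : exists2 z, K z & enorm (p - z) = rho ^+ n * enorm (p - y).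
  elim: n => [|n [z Kz pz]]; first by exists y => //; rewrite mul1r.
  exists (A *m z + b); first exact: Kb.
  by rewrite -{1}pE opprD addrACA subrr addr0 -mulmxBr HA pz mulrA exprS.
have [n nP] : exists n, rho ^+ n * (enorm (p - y) + 1) < e.
  near \oo => n; exists n.
  rewrite -ltr_pdivlMr ?ltr_wpDl ?enorm_ge0//; apply: le_lt_trans (ler_norm _) _.
  near: n; have : `|rho| < 1 by rewrite gtr0_norm.
  move=> /cvg_expr/cvgr0Pnorm_lt; apply.
  by rewrite divr_gt0// ltr_wpDl// enorm_ge0.
have [z Kz pz] := approx n; exists z => //; rewrite pz.
by apply: le_lt_trans nP; rewrite ler_pM2l ?exprn_gt0// lerDl.
Unshelve. all: by end_near.
Qed.

Theorem theorem1p2 (R : realType) (d : nat) (K : set 'cV[R]_d)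
    (K_hom : homogeneous_self_similar K)
    (K_not_singleton : ~ exists x : 'cV[R]_d, K = [set x]) :
  packing_sumset_property K.
Proof.
have [m [rho [U [b [K_neq0 cptK rho01 UO KE]]]]] := K_hom.
have [j0] : exists j0 : 'I_m, True.
  by have [x] := K_neq0; rewrite KE => -[j _ _]; exists j.
move=> _; move: (rho01 j0) (UO j0) => {}rho01 {}UO.
pose A : 'M[R]_d := rho *: U.
have HA (x : 'cV[R]_d) : enorm (A *m x) = rho * enorm x.
  rewrite -scalemxAl enormZ enorm_orthogonal// gtr0_norm//.
  by case/andP: rho01.
have fK x j : K x -> K (A *m x + b j).
  by move=> Kx; rewrite KE; exists j => //; exists x; rewrite // /similitude scalemxAl.
have Kf x : K x -> exists y j, K y /\ x = A *m y + b j.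
  rewrite {1}KE => -[j _ [y Ky <-]]; exists y, j; split=> //.
  by rewrite /similitude scalemxAl.
have [p Kp pE] := affine_fixpoint A rho K (b j0) rho01 HA cptK K_neq0 (fun x => fK x j0).
(* Moving the fixed point [p] of the map of index [j0] to the origin puts 0 in the set and turns the
   translations into the digits [b j - b j0], among them 0. *)
pose K' : set 'cV[R]_d := [set x | K (x + p)].
pose D : set 'cV[R]_d := range (fun j => b j - b j0).
have shift (x : 'cV[R]_d) j : A *m (x - p) + (b j - b j0) = A *m x + b j - p.
  by rewrite -{2}pE mulmxBr !opprD addrACA !addrA addrAC.
have translate_compact c (E : set 'cV[R]_d) : compact E -> compact [set x + c | x in E].
  move=> cptE; apply: continuous_compact => //; apply: continuous_subspaceT.
  by move=> x; apply: (@continuousD R 'cV[R]_d _ id (cst c)) => //; exact: cst_continuous.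
have cptK' : compact K'.
  suff -> : K' = [set x - p | x in K] by exact: translate_compact.
  apply/seteqP; split=> x; first by exists (x + p); rewrite ?addrK.
  by move=> [y Ky <-]; rewrite /K'/= subrK.
have dimK' : packing_dim K' = packing_dim K.
  apply/eqP; rewrite eq_le (packing_dim_translate p)//=.
  by apply: (packing_dim_translate (- p)) => x Kx; rewrite /K'/= subrK.
have K'0 : K' 0 by rewrite /K'/= add0r.
have D0 : D 0 by exists j0; rewrite // subrr.
have DK' x t : K' x -> D t -> K' (A *m x + t).
  move=> K'x [j _ <-]; rewrite /K'/= -[x](addrK p) shift subrK; exact: fK.
have K'D x : K' x -> exists y t, [/\ K' y, D t & x = A *m y + t].
  move=> /Kf[y [j [Ky xE]]]; exists (y - p), (b j - b j0); split.
  - by rewrite /K'/= subrK.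
  - by exists j.
  - by rewrite shift -xE addrK.
move=> l l2.
have l0 : (0 < l)%N by exact: ltnW.
have [B [cptB BK dimB]] := sumset_splitting A rho D K' 'I_l (Ordinal l0) rho01 HA
  cptK' K'0 D0 DK' K'D.
(* The translation by [p] is shared equally among the [l] summands. *)
pose c := l%:R^-1 *: p.
exists (fun i => [set x + c | x in B i]); split.
- by move=> i; exact: translate_compact.
- move=> _ [x Bx <-].
  have /BK : forall i, B i (x i - c) by move=> i; have [y By <-] := Bx i; rewrite addrK.
  rewrite sumrB sumr_const card_ord /K'/= /c -scaler_nat scalerA mulfV ?scale1r ?subrK//.
  by rewrite pnatr_eq0 -lt0n.
- move=> i; rewrite -dimK' -(dimB i); apply/eqP; rewrite eq_le.
  rewrite (packing_dim_translate (- c)) => [|_ [x Bx <-]]; last by rewrite addrK.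
  by rewrite (packing_dim_translate c)// => x Bx; exists x.
Qed.
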